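(* Let $n\geq 95$ be an integer, and let $T_{a,b}$ be balanced with $a+b=n-3$, i.e. $a=\left\lfloor\frac{n-3}{2}\right\rfloor$ and $b=\left\lceil\frac{n-3}{2}\right\rceil$. Then $$\sigma(P_n, T_{a,b})>\sigma(P_n,K_{1,n-1}).$$
   Context: All graphs are finite, simple and undirected. For a graph $G$ on $n$ vertices, $\lambda_1(G)\geq\lambda_2(G)\geq\cdots\geq\lambda_n(G)$ denote the eigenvalues of its adjacency matrix, with multiplicity, in non-increasing order. The spectral distance between two graphs $G,H$ on $n$ vertices is $\sigma(G,H)=\sum_{i=1}^{n}|\lambda_i(G)-\lambda_i(H)|$. $P_n$ is the path on $n$ vertices and $K_{1,n-1}$ is the star on $n$ vertices. For integers $a,b\geq 1$, $T_{a,b}$ is the tree on $a+b+3$ vertices obtained from disjoint stars $K_{1,a+1}$ and $K_{1,b+1}$ by identifying a pendant vertex (vertex of degree 1) of $K_{1,a+1}$ with a pendant vertex of $K_{1,b+1}$; that is, it has two centers, with $a$ and $b$ pendant neighbours respectively, joined through one common neighbour. $T_{a,b}$ is called balanced if $a=\left\lfloor\frac{a+b}{2}\right\rfloor$ and $b=\left\lceil\frac{a+b}{2}\right\rceil$, i.e. $b=a$ or $b=a+1$. *)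

(* Defs.v *)
From HB Require Import structures.
From mathcomp Require Import all_boot all_order all_algebra.
From mathcomp Require Import polyrcf.
From mathcomp Require Import reals.

Set Implicit Arguments.
Unset Strict Implicit.
Unset Printing Implicit Defensive.

Import Order.TTheory GRing.Theory Num.Theory.

Local Open Scope ring_scope.

Record sgraph := SGraph {
  vertex :> finType;
  adj : rel vertex;
  adj_sym : symmetric adj;
  adj_irr : irreflexive adj
}.

Definition path_adj n : rel 'I_n := 
  fun i j => (i.+1 == j :> nat) || (j.+1 == i :> nat).

Lemma path_adj_sym n : symmetric (@path_adj n).
Proof. by move=> i j; rewrite /path_adj orbC. Qed.

Lemma path_adj_irr n : irreflexive (@path_adj n).
Proof. by move=> i; rewrite /path_adj orbb gtn_eqF. Qed.

Definition path_graph n := SGraph (@path_adj_sym n) (@path_adj_irr n).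

(* [star m] is K_{1,m}: the centre is [None], the m leaves are [Some i]. *)
Definition star_adj m : rel (option 'I_m) := fun x y => isSome x != isSome y.

Lemma star_adj_sym m : symmetric (@star_adj m).
Proof. by move=> x y; rewrite /star_adj eq_sym. Qed.

Lemma star_adj_irr m : irreflexive (@star_adj m).
Proof. by move=> x; rewrite /star_adj eqxx. Qed.

Definition star m := SGraph (@star_adj_sym m) (@star_adj_irr m).

(* T_{a,b}: [None] is the common neighbour of the two centres, which are
   [Some (inl None)] (pendant neighbours [Some (inl (Some i))], i < a) and
   [Some (inr None)] (pendant neighbours [Some (inr (Some j))], j < b). *)
Definition two_star_adj a b : rel (option (star a + star b)) := fun x y =>
  match x, y with
  | None, Some (inl u) | Some (inl u), None => u == None
  | None, Some (inr v) | Some (inr v), None => v == None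
  | Some (inl u), Some (inl u') => adj u u'
  | Some (inr v), Some (inr v') => adj v v'
  | _, _ => false
  end.

Lemma two_star_adj_sym a b : symmetric (@two_star_adj a b).
Proof. by move=> [[u|v]|] [[u'|v']|] //=; exact: star_adj_sym. Qed.

Lemma two_star_adj_irr a b : irreflexive (@two_star_adj a b).
Proof. by move=> [[u|v]|] //=; exact: star_adj_irr. Qed.

Definition two_star a b :=
  SGraph (@two_star_adj_sym a b) (@two_star_adj_irr a b).

Definition balanced a b := a = (a + b)./2 /\ b = uphalf (a + b).

Lemma card_path_graph n : #|path_graph n| = n.
Proof. exact: card_ord. Qed.

Lemma card_star m : #|star m| = m.+1.
Proof. by rewrite card_option card_ord. Qed.

Lemma card_two_star a b : #|two_star a b| = (a + b + 3)%N.
Proof.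
by rewrite card_option card_sum !card_option !card_ord addSn addnS addn3.
Qed.

Definition adjmx (R : realType) (G : sgraph) : 'M[R]_#|G| :=
  \matrix_(i, j) (adj (enum_val i) (enum_val j))%:R.

(* The real roots of the characteristic polynomial, each repeated according to
   its multiplicity, in non-increasing order ([rootsR] is increasing). *)
Definition eigenvalues (R : realType) n (A : 'M[R]_n) : seq R :=
  flatten [seq nseq (mup x (char_poly A)) x | x <- rev (rootsR (char_poly A))].

Lemma eigenvaluesE (R : realType) n (A : 'M[R]_n) (s : seq R) :
  sorted >=%R s -> char_poly A = \prod_(x <- s) ('X - x%:P) ->
  eigenvalues A = s.
Proof.
move=> s_sorted chA; have nzA : char_poly A != 0.
  by rewrite monic_neq0 ?char_poly_monic.
apply: (@sorted_eq _ >=%R) => //.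
- exact: ge_trans.
- exact: ge_anti.
- rewrite /eigenvalues; set t := rev _.
  have: sorted >%R t by rewrite rev_sorted sorted_roots.
  rewrite !sorted_pairwise; [|exact: ge_trans|exact: (rev_trans lt_trans)].
  elim: t => //= x t IHt /andP[xt /IHt pt]; rewrite pairwise_cat pt andbT.
  apply/andP; split.
    apply/allrelP => y z; rewrite mem_nseq => /andP[_ /eqP ->].
    case/flatten_mapP => w wt; rewrite mem_nseq => /andP[_ /eqP ->].
    exact/ltW/(allP xt).
  by elim: (mup _ _) => //= k ->; rewrite all_nseq /= lexx orbT.
- apply/allP => x _ /=; apply/eqP.
  rewrite count_flatten -map_comp -(mu_prod_XsubC x s) -chA.
  under eq_map => y do rewrite /= count_nseq /=.
  rewrite sumnE big_map.
  have [xr|/negP xr] := boolP (x \in rev (rootsR (char_poly A))).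
    rewrite (bigD1_seq x) ?rev_uniq ?uniq_roots //= eqxx mul1n.
    by rewrite big1 ?addn0 // => y /negPf ->.
  rewrite mupNroot; last first.
    by apply/negP => rx; apply: xr; rewrite mem_rev -roots_on_rootsR // rx.
  by rewrite big1_seq // => y /andP[_ yr]; case: eqP => // yx; rewrite -yx in xr.
Qed.

(* Indices start from 0: [lambda R G i] is the (i+1)-st largest eigenvalue. *)
Definition lambda (R : realType) (G : sgraph) (i : nat) : R :=
  (eigenvalues (adjmx R G))`_i.

(* Only meaningful for graphs with the same number of vertices. *)
Definition spectral_distance (R : realType) (G H : sgraph) : R :=
  \sum_(i < #|G|) `|lambda R G i - lambda R H i|.

(* Main.v *)
Require Import Defs.
From mathcomp Require Import all_boot all_order all_algebra.
From mathcomp Require Import reals polyrcf ring lra zify.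

(** Adjacency matrices of the star and of T_(a,b) have rank 2 and 4, so each
    of these graphs has almost only zero eigenvalues: the star has +-r with
    r = sqrt (n - 1), and T_(a,b) has +-mu, +-nu with mu >= nu >= 0,
    mu^2 + nu^2 = n - 1 and (mu nu)^2 = ab + a + b. All other eigenvalues
    vanish in both graphs, so the two distances to the path differ only in the
    two largest and the two smallest indices.

    About the path it is enough to know that its eigenvalues lie in [-2, 2],
    which holds because its degrees are at most 2
    ([eigenvalue_adjmx_le]). Write p_i for these eigenvalues. When
    r, mu, nu >= 2, the absolute values in the terms that involve r, mu or nu
    can be removed, the values p_1 and p_n cancel, and the difference of the
    distances is
    2 (mu + nu - r) - (p_2 + |p_2|) + (p_(n-1) - |p_(n-1)|),
    which is at least 2 (mu + nu - r - 4). So it remains to see that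
    mu + nu > r + 4. Balance gives (a - b)^2 <= 1, hence
    4 (mu nu)^2 = (n - 1)^2 - (a - b)^2 - 4 >= (n - 1)^2 - 5, and therefore
    (mu + nu)^2 >= (n - 1) + sqrt ((n - 1)^2 - 5), which exceeds (r + 4)^2 as
    soon as n >= 95 ([sqrt_add4_lt]).

    The two spectra come from one computation. In both graphs some set of k
    pairwise non-adjacent vertices meets every edge (the centre of the star, the
    two centres of T_(a,b)). The adjacency matrix then factors through
    dimension 2k, and Sylvester's determinant identity reduces its
    characteristic polynomial to the k x k determinant of X^2 - B, where B
    counts the common neighbours of the chosen vertices
    ([char_poly_adjmx_cover]). *)

Import Order.TTheory GRing.Theory Num.Theory.

Local Open Scope ring_scope.

(** * Characteristic polynomials of bipartite graphs *)

(** Sylvester's identity: the block matrix [M] becomes block triangular with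
    diagonal [x - U V, 1] or [x, x - V U], after two different column
    operations. *)
Lemma det_subr_mulmxC (R : comNzRingType) n k (x : R)
    (U : 'M_(n, k)) (V : 'M_(k, n)) :
  x ^+ k * \det (x%:M - U *m V) = x ^+ n * \det (x%:M - V *m U).
Proof.
pose M := block_mx x%:M U V 1%:M.
have lowerE : M *m block_mx 1%:M 0 (- V) 1%:M =
    block_mx (x%:M - U *m V) U 0 1%:M.
  by rewrite mulmx_block !mulmx1 !mulmx0 !mulmxN mul1mx add0r addrN add0r.
have upperE : M *m block_mx 1%:M (- U) 0 x%:M =
    block_mx x%:M 0 V (x%:M - V *m U).
  rewrite mulmx_block !mulmx1 !mulmx0 !mulmxN !addr0 mul1mx.
  by rewrite mul_scalar_mx mul_mx_scalar addNr addrC.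
have := congr1 determinant lowerE.
have := congr1 determinant upperE.
rewrite !det_mulmx !det_lblock !det_ublock !det_scalar !expr1n !mul1r !mulr1.
by move=> upper <-; rewrite mulrC.
Qed.

(** The spectrum of a matrix with zero diagonal blocks is governed by [x ^+ 2]:
    adding the second block column to [x] times the first clears a block. *)
Lemma det_bipartite_block (R : idomainType) k (x : R) (B : 'M_k)
    (nz_x : x != 0) :
  \det (block_mx x%:M (- B) (- 1%:M) x%:M) = \det ((x ^+ 2)%:M - B).
Proof.
apply: (mulIf (expf_neq0 k nz_x)).
have := congr1 determinant
  (mulmx_block x%:M (- B) (- 1%:M) x%:M x%:M 0 1%:M 1%:M).
rewrite !mulmx0 !mulmx1 !mulNmx mul1mx !add0r addNr -scalar_mxM -expr2.
by rewrite det_mulmx det_lblock det_ublock !det_scalar expr1n mulr1.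
Qed.

(** With [C] selecting the rows of a set of vertices and [N] listing their
    neighbourhoods, the sum below is a product of matrices of sizes n x 2k and
    2k x n. The product in the other order is [[0, N N^T], [1, 0]]. *)
Lemma char_poly_vertex_cover (F : fieldType) n k (C N : 'M[F]_(k, n)) :
    C *m C^T = 1%:M -> C *m N^T = 0 ->
  'X^(k + k) * char_poly (C^T *m N + N^T *m C)
    = 'X^n * \det ('X^2%:M - map_mx polyC (N *m N^T)).
Proof.
move=> CC CN; have NC : N *m C^T = 0.
  by rewrite -[LHS]trmxK trmx_mul trmxK CN trmx0.
rewrite /char_poly /char_poly_mx -mul_row_col map_mxM det_subr_mulmxC -map_mxM.
rewrite mul_col_row CC CN NC map_block_mx map_mx0 map_mx1 scalar_mx_block.
rewrite opp_block_mx add_block_mx !oppr0 !add0r !addr0.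
by rewrite det_bipartite_block ?polyX_eq0.
Qed.

(** Since the vertices [c s] form an independent vertex cover, every edge has
    exactly one endpoint among them, and this splits the adjacency matrix as
    [C^T N + N^T C]. *)
Lemma char_poly_adjmx_cover (R : realType) (G : sgraph) k (c : 'I_k -> G) :
    injective c -> (forall s t, ~~ adj (c s) (c t)) ->
    (forall u v : G, adj u v -> (u \in codom c) || (v \in codom c)) ->
  'X^(k + k) * char_poly (adjmx R G)
    = 'X^#|G| * \det ('X^2%:M - \matrix_(s, t)
        (\sum_(v : G) (adj (c s) v)%:R * (adj (c t) v)%:R)%:P).
Proof.
move=> c_inj c_indep c_cover.
pose C : 'M[R]_(k, #|G|) := \matrix_(s, i) (c s == enum_val i)%:R.
pose N : 'M[R]_(k, #|G|) := \matrix_(s, i) (adj (c s) (enum_val i))%:R.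
have sumG (f : G -> R) : \sum_(i < #|G|) f (enum_val i) = \sum_(v : G) f v.
  by rewrite -(big_enum_val f).
have CC : C *m C^T = 1%:M.
  apply/matrixP => s t; rewrite !mxE; under eq_bigr do rewrite !mxE.
  rewrite (sumG (fun v => (c s == v)%:R * (c t == v)%:R)) (bigD1 (c s)) //=.
  rewrite eqxx mul1r.
  rewrite big1 ?addr0 => [|v /negPf]; first by rewrite (inj_eq c_inj) eq_sym.
  by rewrite eq_sym => ->; rewrite mul0r.
have CN : C *m N^T = 0.
  apply/matrixP => s t; rewrite !mxE; under eq_bigr do rewrite !mxE.
  rewrite (sumG (fun v => (c s == v)%:R * (adj (c t) v)%:R)) big1 // => v _.
  case: eqP => [<-|_]; last by rewrite mul0r.
  by rewrite (negPf (c_indep t s)) mulr0.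
have AE : adjmx R G = C^T *m N + N^T *m C.
  apply/matrixP => i j; rewrite !mxE.
  (* One summand collects the edges whose first endpoint is in the cover. *)
  have halfE u v : \sum_s (c s == u)%:R * (adj (c s) v)%:R
      = ((u \in codom c) && adj u v)%:R :> R.
    have [/codomP[s ->]|uNc] /= := boolP (u \in codom c).
      rewrite (bigD1 s) //= eqxx mul1r big1 ?addr0 // => t /negPf.
      by rewrite (inj_eq c_inj) => ->; rewrite mul0r.
    rewrite big1 // => s _; case: eqP => [cs|_]; last by rewrite mul0r.
    by rewrite -cs codom_f in uNc.
  under eq_bigr do rewrite !mxE.
  under [X in _ = _ + X]eq_bigr do rewrite !mxE mulrC.
  rewrite !halfE (adj_sym (enum_val j)) -natrD; congr _%:R.
  case Auv: (adj _ _); rewrite ?andbF // !andbT.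
  have := c_cover _ _ Auv.
  case: codomP => [[s us]|_]; case: codomP => [[t vt]|_] //=.
  by move: Auv; rewrite us vt (negPf (c_indep s t)).
rewrite AE char_poly_vertex_cover //; congr (_ * \det (_ - _)).
apply/matrixP => s t; rewrite !mxE; congr _%:P; under eq_bigr do rewrite !mxE.
by rewrite (sumG (fun v => (adj (c s) v)%:R * (adj (c t) v)%:R)).
Qed.

(** * Bounding the spectrum of the path *)

(** Compare both sides of the eigenvector equation at a coordinate of largest
    absolute value. *)
Lemma eigenvalue_adjmx_le (R : realType) (G : sgraph) d x :
    (forall v : G, #|[pred u | adj v u]| <= d)%N ->
  eigenvalue (adjmx R G) x -> `|x| <= d%:R.
Proof.
move=> degG /eigenvalueP[v vA nz_v].
have [i0 _] : exists i, v 0 i != 0.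
  by apply/existsP; apply: contraNT nz_v => /existsPn v0;
     apply/eqP/rowP => i; rewrite mxE; apply/eqP; have := v0 i; rewrite negbK.
have [j _ jmax] := arg_maxP (fun i => `|v 0 i|) (isT : predT i0).
have vj_gt0 : 0 < `|v 0 j|.
  rewrite lt_def normr_ge0 andbT; apply: contraNneq nz_v => vj0.
  apply/eqP/rowP => i; rewrite mxE; apply/eqP; rewrite -normr_le0 -vj0.
  exact: jmax.
rewrite -(ler_pM2r vj_gt0) -normrM.
have := congr1 (fun w : 'rV_#|G| => w 0 j) vA; rewrite !mxE => <-.
apply: le_trans (ler_norm_sum _ _ _) _.
apply: (@le_trans _ _ (\sum_i (adj (enum_val j) (enum_val i))%:R * `|v 0 j|)).
  apply: ler_sum => i _; rewrite mxE normrM normr_nat mulrC.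
  by rewrite (adj_sym (enum_val i)) ler_wpM2l ?ler0n //; apply: jmax.
rewrite -mulr_suml ler_wpM2r ?normr_ge0 //.
rewrite -(big_enum_val (fun u : G => (adj (enum_val j) u)%:R))
  -natr_sum ler_nat.
rewrite (leq_trans _ (degG (enum_val j))) // -sum1_card.
rewrite [leqLHS]big_mkcond [leqRHS]big_mkcond leq_sum // => u _.
Qed.

Lemma mem_eigenvalues (R : realType) n (A : 'M[R]_n) x :
  x \in eigenvalues A -> eigenvalue A x.
Proof.
case/flatten_mapP => y; rewrite mem_rev mem_nseq => yr /andP[_ /eqP ->].
have := roots_on_rootsR (monic_neq0 (char_poly_monic A)) y.
by rewrite yr eigenvalue_root_char => /andP[].
Qed.

(** The default value 0 past the end of the list obeys the bound as well, which
    spares counting the eigenvalues of the path. *)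
Lemma lambda_path_le2 (R : realType) n i : `|lambda R (path_graph n) i| <= 2.
Proof.
have [i_lt|i_ge] := ltnP i
  (size (eigenvalues (adjmx R (path_graph n)))); last first.
  by rewrite /lambda nth_default ?normr0.
apply: (@eigenvalue_adjmx_le _ (path_graph n));
  last exact/mem_eigenvalues/mem_nth.
move=> v; rewrite cardE -(size_map val).
apply: (@leq_trans (size [:: v.+1; v.-1])) => //; apply: uniq_leq_size.
  by rewrite (map_inj_uniq val_inj) enum_uniq.
move=> _ /mapP[u + ->]; rewrite mem_enum !inE /= /path_adj.
by case/orP => /eqP <-; rewrite eqxx ?orbT.
Qed.


(** * Spectra of the star and of two linked stars *)

Lemma big_option (V : nmodType) (T : finType) (f : option T -> V) :
  \sum_x f x = f None + \sum_x f (Some x).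
Proof.
rewrite -big_enum /= enumT [Finite.enum]unlock /= big_cons big_map.
by rewrite -enumT big_enum.
Qed.

Lemma char_poly_star (R : realType) m :
  'X^2 * char_poly (adjmx R (star m)) = 'X^(m.+1) * ('X^2 - m%:R%:P).
Proof.
pose c (_ : 'I_1) : star m := None.
have := @char_poly_adjmx_cover R (star m) 1 c.
rewrite det_mx11 !mxE [X in _ = 'X^X * _]card_star => -> //;
  [|by move=> s t; rewrite !ord1|].
  rewrite big_option /= mul0r add0r.
  rewrite (eq_bigr (fun=> 1)) => [|i _]; last by rewrite mulr1.
  by rewrite sumr_const card_ord.
by move=> [u|] [v|] //= _; apply/orP; [right|left]; apply: (codom_f c ord0).
Qed.

Lemma det_mx2 (R : comNzRingType) (A : 'M[R]_2) :
  \det A = A 0 0 * A 1 1 - A 0 1 * A 1 0.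
Proof.
rewrite (expand_det_row _ 0) !big_ord_recl big_ord0
  addr0 /cofactor !det_mx11 !mxE.
rewrite /= expr0 expr1 mul1r mulN1r mulrN.
by congr (A _ _ * A _ _ - A _ _ * A _ _); apply: val_inj.
Qed.

Lemma char_poly_two_star (R : realType) a b :
  'X^4 * char_poly (adjmx R (two_star a b)) = 'X^(a + b + 3) *
    (('X^2 - a.+1%:R%:P) * ('X^2 - b.+1%:R%:P) - 1).
Proof.
pose c (i : 'I_2) : two_star a b :=
  if i == 0 then Some (inl None) else Some (inr None).
have := @char_poly_adjmx_cover R (two_star a b) 2 c.
rewrite det_mx2 [X in _ = 'X^X * _]card_two_star => -> //; last first.
- move=> [[[x|]|[x|]]|] [[[y|]|[y|]]|] //= _; apply/orP;
  ((left; exact: (codom_f c 0)) || (right; exact: (codom_f c 0)) ||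
   (left; exact: (codom_f c 1)) || (right; exact: (codom_f c 1))).
- by case=> [[|[|?]] ?] [[|[|?]] ?].
- by case=> [[|[|?]] i] [[|[|?]] j] //= _; apply: val_inj.
rewrite !mxE /= !big_option !big_sumType /= !big_option /=.
rewrite ?(mul0r,mulr0,mul1r,mulr1,add0r,addr0).
rewrite !sumr_const !card_ord !mul0rn ?(addr0, add0r) -!mulrS.
by congr (_ * _); ring.
Qed.

Lemma path_nseq_cat (R : numDomainType) m (x y : R) s :
  y <= x -> path >=%R x s -> path >=%R y s -> path >=%R x (nseq m y ++ s).
Proof. by elim: m x => //= m IHm x -> _ ys; rewrite IHm. Qed.

Lemma eigenvalues_star (R : realType) m :
  eigenvalues (adjmx R (star m.+1)) =
    Num.sqrt m.+1%:R :: nseq m 0 ++ [:: - Num.sqrt m.+1%:R].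
Proof.
set r := Num.sqrt _; have r_ge0 : 0 <= r := sqrtr_ge0 _.
apply: eigenvaluesE.
  by rewrite /= path_nseq_cat //= ?andbT ?oppr_le0 // ge0_cp.
apply: (@mulfI _ ('X^2)); first by rewrite expf_eq0 polyX_eq0.
rewrite char_poly_star big_cons big_cat big_seq1 /= big_nseq iter_mulr_1 /=.
rewrite polyC0 subr0 polyCN opprK -[m.+1%:R]sqr_sqrtr ?ler0n // -/r rmorphXn /=.
by rewrite !exprS; ring.
Qed.

(** [mu] and [nu] are specified by their symmetric functions, which are the
    coefficients of the quartic factor of the characteristic polynomial
    and avoid its explicit roots. *)
Lemma eigenvalues_two_star (R : realType) a b k (mu nu : R) :
    0 <= nu <= mu -> mu ^+ 2 + nu ^+ 2 = (a + b + 2)%:R ->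
    (mu * nu) ^+ 2 = (a * b + a + b)%:R -> (a + b = k.+1)%N ->
  eigenvalues (adjmx R (two_star a b)) =
    [:: mu, nu & nseq k 0 ++ [:: - nu; - mu]].
Proof.
move=> /andP[nu_ge0 nu_le] sumE prodE abk; have mu_ge0 := le_trans nu_ge0 nu_le.
apply: eigenvaluesE.
  by rewrite /= nu_le path_nseq_cat //= ?andbT ?oppr_le0 ?lerN2 ?nu_le
    ?nu_ge0 // ge0_cp.
apply: (@mulfI _ ('X^4)); first by rewrite expf_eq0 polyX_eq0.
rewrite char_poly_two_star abk !big_cons big_cat !big_cons big_nil /=.
rewrite big_nseq iter_mulr_1 /=.
rewrite polyC0 subr0 !polyCN !opprK.
(* The linear coefficient in X^2 counts the edges and the constant one the
   pairs of disjoint edges. *)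
have -> : ('X^2 - a.+1%:R%:P) * ('X^2 - b.+1%:R%:P) - 1 =
   'X^2 ^+ 2 - (a + b + 2)%:R%:P * 'X^2 + (a * b + a + b)%:R%:P :> {poly R}.
  by rewrite !polyC_natr; ring.
rewrite -sumE -prodE rmorphD /= !rmorphXn rmorphM /= addn3 !exprS; ring.
Qed.

(** * Comparing the distances *)

Lemma sum_dist_symmetric_spectrum (R : realType) k (p : nat -> R) (x y : R) :
  \sum_(i < k.+4) `|p i - [:: x, y & nseq k 0 ++ [:: - y; - x]]`_i| =
    `|p 0%N - x| + `|p 1%N - y| + \sum_(i < k) `|p i.+2|
    + `|p k.+2 + y| + `|p k.+3 + x|.
Proof.
rewrite 2!big_ord_recl /= 2!big_ord_recr /= !nth_cat size_nseq ltnn subnn.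
rewrite ltnNge leqnSn subSnn /= !opprK !addrA; congr (_ + _ + _ + _ + _).
by apply: eq_bigr => i _; rewrite nth_cat size_nseq ltn_ord nth_nseq
  ltn_ord subr0.
Qed.

(** The squares of [m + n] and [m - n] are forced to be [s + 2 q] and
    [s - 2 q]. *)
Lemma exists_sum_sqr_mul (R : realType) (s q : R) : 0 <= q -> q *+ 2 <= s ->
  exists2 mn : R * R, 0 <= mn.2 <= mn.1
    & mn.1 ^+ 2 + mn.2 ^+ 2 = s /\ mn.1 * mn.2 = q.
Proof.
move=> q_ge0 le_q2s.
pose u := Num.sqrt (s + q *+ 2); pose v := Num.sqrt (s - q *+ 2).
have uE : u ^+ 2 = s + q *+ 2 by rewrite sqr_sqrtr //; lra.
have vE : v ^+ 2 = s - q *+ 2 by rewrite sqr_sqrtr //; lra.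
have u_ge0 : 0 <= u := sqrtr_ge0 _; have v_ge0 : 0 <= v := sqrtr_ge0 _.
have v_le_u : v <= u by rewrite ler_wsqrtr //; lra.
exists ((u + v) / 2, (u - v) / 2) => /=; first by apply/andP; split; lra.
split; nra.
Qed.

(** After squaring, the claim is [4 r + 8 < q]; squaring again, it follows from
    [r^4 - 5 > 64 (r + 2)^2], which holds for [94 <= r^2] and narrowly fails at
    [r^2 = 93]. *)
Lemma sqrt_add4_lt (R : realType) (s r q mu nu : R) :
    94 <= s -> 0 <= r -> r ^+ 2 = s -> 0 <= q -> s ^+ 2 - 5 <= 4 * q ^+ 2 ->
    0 <= mu -> 0 <= nu -> mu ^+ 2 + nu ^+ 2 = s -> mu * nu = q ->
  r + 4 < mu + nu.
Proof.
move=> s_ge r_ge0 rE q_ge0 le_q mu_ge0 nu_ge0 sumE prodE.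
(* A rational lower bound for sqrt 94, sharp enough for the quartic bound. *)
have r_ge : 969 / 100 <= r by nra.
have q_gt : 4 * r + 8 < q.
  rewrite ltNge; apply/negP => q_le.
  have : q ^+ 2 <= (4 * r + 8) ^+ 2 by rewrite lerXn2r // nnegrE; lra.
  nra.
rewrite ltNge; apply/negP => sum_le.
have : (mu + nu) ^+ 2 <= (r + 4) ^+ 2 by rewrite lerXn2r // nnegrE; lra.
nra.
Qed.

Theorem theorem7 (R : realType) (n a b : nat) (hn : (95 <= n)%N)
    (hab : (a + b = n - 3)%N) (hbal : balanced a b) :
  spectral_distance R (path_graph n) (star n.-1) <
    spectral_distance R (path_graph n) (two_star a b).
Proof.
have [k nE] : {k | n = k.+4} by exists (n - 4)%N; lia.
have abk : (a + b = k.+1)%N by lia.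
subst n.
pose s : R := (a + b + 2)%:R; pose d : R := a%:R - b%:R.
have sE : s = k.+3%:R by rewrite /s abk addn2.
have d_small : d ^+ 2 <= 1.
  have ab_cases : b = a \/ b = a.+1 by case: hbal => ? ?; lia.
  by rewrite /d; case: ab_cases => ->;
    [rewrite subrr expr0n ler01 | rewrite -natr1; lra].
pose q := Num.sqrt ((a * b + a + b)%:R : R).
have q_ge0 : 0 <= q := sqrtr_ge0 _.
have qE : q ^+ 2 = (a * b + a + b)%:R by rewrite sqr_sqrtr.
have discE : s ^+ 2 - 4 * q ^+ 2 = d ^+ 2 + 4.
  by rewrite qE /s /d !natrD natrM; ring.
have s_ge : 94 <= s by rewrite sE ler_nat; lia.
have q2_le : q *+ 2 <= s.
  by rewrite -(@ler_pXn2r _ 2) ?nnegrE ?mulrn_wge0 //; nra.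
have [[mu nu] /= /andP[nu_ge0 nu_le] [sumE prodE]] :=
  exists_sum_sqr_mul _ _ _ q_ge0 q2_le.
pose r := Num.sqrt s.
have r_ge0 : 0 <= r := sqrtr_ge0 _.
have rE : r ^+ 2 = s by rewrite sqr_sqrtr //; lra.
have r_ge2 : 2 <= r by nra.
(* mu^2 and nu^2 have the large sum s but a difference at most sqrt 5. *)
have nu_ge2 : 2 <= nu.
  rewrite leNgt; apply/negP => nu_lt.
  have nu2_lt : nu ^+ 2 < 4 by nra.
  have : (mu ^+ 2 - nu ^+ 2) ^+ 2 <= 5 by nra.
  nra.
have mu_ge2 : 2 <= mu by lra.
have gap : r + 4 < mu + nu.
  by apply: (@sqrt_add4_lt _ s r q) => //; lra.
(* Padding the star with the pair 0, - 0 puts both spectra in one shape. *)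
have starE i : lambda R (star k.+3) i =
    [:: r, 0 & nseq k 0 ++ [:: - 0; - r]]`_i.
  by rewrite /lambda eigenvalues_star -sE -/r oppr0 -(addn1 k.+1) nseqD -catA.
have twoE i : lambda R (two_star a b) i =
    [:: mu, nu & nseq k 0 ++ [:: - nu; - mu]]`_i.
  rewrite /lambda (@eigenvalues_two_star _ _ _ k mu nu) ?nu_ge0 //.
  by rewrite prodE.
rewrite /spectral_distance card_path_graph.
under eq_bigr do rewrite starE.
under [ltRHS]eq_bigr do rewrite twoE.
set p := lambda R (path_graph _).
rewrite !(sum_dist_symmetric_spectrum _ _ p) subr0 addr0.
have /ler_normlP[p0l p0u] : `|p 0%N| <= 2 := lambda_path_le2 _ _ _.
have p1 : `|p 1%N| <= 2 := lambda_path_le2 _ _ _.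
have p2 : `|p k.+2| <= 2 := lambda_path_le2 _ _ _.
have /ler_normlP[p3l p3u] : `|p k.+3| <= 2 := lambda_path_le2 _ _ _.
have p1u := ler_norm (p 1%N); have p2l := lerNnormlW p2.
(* Only the signs of the second and of the last but one eigenvalues of the path
   are left open. *)
rewrite (ler0_norm (_ : p 0%N - r <= 0))
  ?(ler0_norm (_ : p 0%N - mu <= 0)); [|lra|lra].
rewrite (ler0_norm (_ : p 1%N - nu <= 0)); last lra.
rewrite (ger0_norm (_ : 0 <= p k.+2 + nu)); last lra.
rewrite (ger0_norm (_ : 0 <= p k.+3 + r))
  ?(ger0_norm (_ : 0 <= p k.+3 + mu)); [|lra|lra].
lra.
Qed.
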